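(* Let $\mathcal X$ be a real linear space, $\mathcal Y$ a real Banach space, and $r,s,t$ positive integers. Let $f,g,h:\mathcal X\to\mathcal Y$ be mappings with $f(0)=g(0)=h(0)=0$ for which there exists a function $\varphi:\mathcal X\times\mathcal X\to[0,\infty)$ such that, for all $x,y\in\mathcal X$, $$\widetilde\varphi(x,y):=\frac1{2r}\sum_{n=0}^\infty\frac1{2^n}\left[\varphi\!\left(2^n\tfrac rs x,2^n\tfrac rt y\right)+\varphi\!\left(2^n\tfrac rs x,0\right)+\varphi\!\left(0,2^n\tfrac rt y\right)\right]<\infty$$ and $$\left\|r f\!\left(\frac{sx+ty}{r}\right)-s\,g(x)-t\,h(y)\right\|\le\varphi(x,y).$$ Then there exists a unique additive map $T:\mathcal X\to\mathcal Y$ such that, for all $x\in\mathcal X$, $$\|f(x)-T(x)\|\le\widetilde\varphi(x,x),$$ $$\|g(x)-T(x)\|\le\frac1s\varphi(x,0)+\frac rs\,\widetilde\varphi\!\left(\tfrac sr x,\tfrac sr x\right),$$ $$\|h(x)-T(x)\|\le\frac1t\varphi(0,x)+\frac rt\,\widetilde\varphi\!\left(\tfrac tr x,\tfrac tr x\right).$$ Furthermore, if for each fixed $x\in\mathcal X$ the mapping $\mu\mapsto f(\mu x)$ from $\mathbb R$ to $\mathcal Y$ is continuous, then the additive map $T$ is $\mathbb R$-linear.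
   Context: A map $T$ between linear spaces is additive if $T(x+y)=T(x)+T(y)$ for all $x,y$. *)

(* Defs.v *)
From HB Require Import structures.
From mathcomp Require Import all_boot all_order all_algebra.
From mathcomp Require Import all_classical all_reals all_analysis.

Set Implicit Arguments.
Unset Strict Implicit.
Unset Printing Implicit Defensive.

Import Order.TTheory GRing.Theory Num.Theory.
Import numFieldNormedType.Exports.

Local Open Scope classical_set_scope.
Local Open Scope ring_scope.

Section PexiderControl.
Variables (R : realType) (X : lmodType R) (r s t : nat) (phi : X -> X -> R).

Definition phi_term (x y : X) (n : nat) : R :=
  let x' := (2 ^+ n * (r%:R / s%:R)) *: x in
  let y' := (2 ^+ n * (r%:R / t%:R)) *: y in
  (2 ^+ n)^-1 * (phi x' y' + phi x' 0 + phi 0 y').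

(* Valued in the extended reals: for nonnegative phi the series always has a
   sum there, and finiteness of that sum is expressed by [< +oo]. *)
Definition phi_tilde (x y : X) : \bar R :=
  ((2 * r%:R)^-1%:E * \sum_(0 <= n <oo) (phi_term x y n)%:E)%E.

End PexiderControl.

Definition pexider_approx (R : realType) (X : lmodType R)
    (Y : completeNormedModType R) (r s t : nat) (f g h : X -> Y)
    (phi : X -> X -> R) (T : X -> Y) : Prop :=
  [/\ {morph T : x y / x + y},
      forall x, (`|f x - T x|%:E <= phi_tilde r s t phi x x)%E,
      forall x, (`|g x - T x|%:E <= (s%:R^-1 * phi x 0)%:E +
        (r%:R / s%:R)%:E *
        phi_tilde r s t phi ((s%:R / r%:R) *: x) ((s%:R / r%:R) *: x))%E &
      forall x, (`|h x - T x|%:E <= (t%:R^-1 * phi 0%R x)%:E +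
        (r%:R / t%:R)%:E *
        phi_tilde r s t phi ((t%:R / r%:R) *: x) ((t%:R / r%:R) *: x))%E].

(* Main.v *)
Require Import Defs.
From HB Require Import structures.
From mathcomp Require Import all_boot all_order all_algebra.
From mathcomp Require Import all_classical all_reals all_analysis.

Import Order.TTheory GRing.Theory Num.Theory.
Import numFieldNormedType.Exports.

Local Open Scope classical_set_scope.
Local Open Scope ring_scope.

(* Substituting [(r/s) x, (r/t) y], and using the two cases where one variable
   is 0, eliminates g and h: f is approximately additive. Hence the dyadic
   rescalings [2^-n f (2^n x)] converge to an additive map T (the direct method
   of Hyers and Gavruta), and every additive map within the same error of f is
   that limit. For linearity, [u |-> T (u x)] is a pointwise limit of continuous
   functions, so by Baire's theorem it is bounded near some point, and a locally
   bounded additive function on R is linear. *)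

(** * Tails of convergent series *)

Lemma series_shift {V : zmodType} (u : V ^nat) (n : nat) :
  series (fun k => u (n + k)%N) = (fun m => series u (m + n)%N - series u n).
Proof.
apply/funext => m; rewrite /series /= (big_cat_nat (leq0n n) (leq_addl m n)) /=.
rewrite addrAC subrr add0r -{2}[n]add0n big_addn addnK.
by apply: eq_bigr => i _; rewrite addnC.
Qed.

Lemma cvg_series_tail {R : realType} {V : normedModType R} {u : V ^nat} :
  cvgn (series u) ->
  limn (series (fun k => u (n + k)%N)) @[n --> \oo] --> 0.
Proof.
move=> cu.
have -> : (fun n => limn (series (fun k => u (n + k)%N))) =
          (fun n => limn (series u) - series u n).
  apply/funext => n; apply/cvg_lim => //; rewrite series_shift.
  by apply: cvgB; [rewrite cvg_shiftn|exact: cvg_cst].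
by rewrite -(subrr (limn (series u))); apply: cvgB => //; exact: cvg_cst.
Qed.

(** * The direct method: dyadic rescalings and their limit *)

Section Dyadic.
Context {R : realType} {X : lmodType R} {Y : completeNormedModType R}.
Implicit Types (f T : X -> Y) (x y : X).

Definition dyadic f (n : nat) x : Y := (2 ^+ n)^-1 *: f (2 ^+ n *: x).

Definition dyadic_lim f x : Y := limn (fun n => dyadic f n x).

Definition dyadic_error (e : X -> R) x (n : nat) : R :=
  (2 ^+ n)^-1 * e (2 ^+ n *: x).

Lemma exp2_gt0 (n : nat) : 0 < 2 ^+ n :> R.
Proof. exact: exprn_gt0. Qed.

Lemma norm_dyadic_scale (n : nat) (v : Y) :
  `|(2 ^+ n)^-1 *: v| = (2 ^+ n)^-1 * `|v|.
Proof. by rewrite normrZ gtr0_norm // invr_gt0 exp2_gt0. Qed.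

(** For uniqueness: the tail at [x] from rank [n] is the whole series at [2 ^+ n *: x], rescaled. *)
Lemma dyadic_error_shift (e : X -> R) x (n : nat) :
  (fun k => dyadic_error e x (n + k)%N) =
  (2 ^+ n)^-1 *: dyadic_error e (2 ^+ n *: x).
Proof.
apply/funext => k.
rewrite -[RHS]/((2 ^+ n)^-1 * dyadic_error e (2 ^+ n *: x) k).
rewrite /dyadic_error scalerA -exprD (addnC k n) mulrA.
by rewrite exprD invfM.
Qed.

(** An additive [T] is fixed by the dyadic rescaling, so the distance from [dyadic f n x] to [T x]
    is a rescaled error of [f] at [2 ^+ n *: x]. *)
Lemma dyadic_cvg_unique {f T} {E : X -> R} {x} :
  {morph T : x y / x + y} -> (forall z, `|f z - T z| <= E z) ->
  dyadic_error E x n @[n --> \oo] --> 0 -> dyadic f n x @[n --> \oo] --> T x.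
Proof.
move=> addT fTE E0; apply/subr_cvg0/norm_cvg0P => /=.
apply: (squeeze_cvgr _ (cvg_cst 0) E0); near=> n; rewrite normr_ge0 /=.
have T2 : T (2 ^+ n *: x) = 2 ^+ n *: T x.
  elim: (n) => [|k IH]; first by rewrite !expr0 !scale1r.
  by rewrite exprS -!scalerA !(scaler_nat 2) !mulr2n addT IH.
rewrite /dyadic -[T x](scalerK (lt0r_neq0 (exp2_gt0 n))) -T2 -scalerBr.
by rewrite norm_dyadic_scale ler_pM2l ?invr_gt0 ?exp2_gt0.
Unshelve. all: by end_near. Qed.

Section Limit.
Context {f : X -> Y} {e : X -> R}.
Hypothesis f_half : forall x, `|f x - 2^-1 *: f (2 *: x)| <= e x.
Hypothesis e_summable : forall x, cvgn (series (dyadic_error e x)).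

Lemma dyadic_step x (n : nat) :
  `|telescope (fun n => dyadic f n x) n| <= dyadic_error e x n.
Proof.
rewrite /telescope distrC /dyadic exprS invfM (mulrC 2^-1) -!scalerA -scalerBr.
by rewrite norm_dyadic_scale ler_pM2l ?invr_gt0 ?exp2_gt0.
Qed.

Lemma series_dyadic x :
  series (telescope (fun n => dyadic f n x)) =
  (fun n => dyadic f n x - f x).
Proof.
rewrite telescopeK; apply/funext => n.
by rewrite {2}/dyadic expr0 invr1 !scale1r.
Qed.

Lemma dyadic_normed_cvg x :
  cvgn [normed series (telescope (fun n => dyadic f n x))].
Proof.
apply: (series_le_cvg _ _ (dyadic_step x) (e_summable x)) => // n.
exact: le_trans (dyadic_step x n).
Qed.

(** The increments are dominated by a summable series, so they converge absolutely, hence converge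
    by completeness of [Y]. *)
Lemma dyadic_is_cvg x : cvgn (fun n => dyadic f n x).
Proof.
have /normed_cvg := dyadic_normed_cvg x; rewrite series_dyadic => /cvg_ex[l fl].
apply/cvg_ex; exists (l + f x).
under eq_fun do rewrite -(subrK (f x) (dyadic f _ x)).
by apply: cvgD => //; exact: cvg_cst.
Qed.

Lemma dyadic_lim_le x :
  `|f x - dyadic_lim f x| <= limn (series (dyadic_error e x)).
Proof.
have cf : `|dyadic f n x - f x| @[n --> \oo] --> `|dyadic_lim f x - f x|.
  by apply: cvg_norm; apply: cvgB; [exact: dyadic_is_cvg|exact: cvg_cst].
rewrite distrC -(cvg_lim _ cf) //; apply: ler_lim; first by apply/cvgP: cf.
  exact: e_summable.
near=> n.
have <- : series (telescope (fun n => dyadic f n x)) n = dyadic f n x - f x.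
  by rewrite series_dyadic.
rewrite /series /=; apply: le_trans (ler_norm_sum _ _ _) _.
by apply: ler_sum => i _; exact: dyadic_step.
Unshelve. all: by end_near. Qed.

(** The additivity defect of [dyadic f n] is the defect of [f] at the points scaled by [2 ^+ n],
    divided by [2 ^+ n]. *)
Lemma dyadic_limD {c : X -> X -> R} :
  (forall x y, `|f (x + y) - f x - f y| <= c x y) ->
  (forall x y,
     (2 ^+ n)^-1 * c (2 ^+ n *: x) (2 ^+ n *: y) @[n --> \oo] --> 0) ->
  {morph dyadic_lim f : x y / x + y}.
Proof.
move=> fc c0 x y; apply/eqP; rewrite -subr_eq0 opprD addrA.
have : (dyadic f n (x + y) - dyadic f n x - dyadic f n y) @[n --> \oo] -->
    dyadic_lim f (x + y) - dyadic_lim f x - dyadic_lim f y.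
  by apply: cvgB; [apply: cvgB|]; exact: dyadic_is_cvg.
move=> cD; apply/eqP; apply: (cvg_unique _ cD) => //; apply/norm_cvg0P.
apply: (squeeze_cvgr _ (cvg_cst 0) (c0 x y)); near=> n; rewrite normr_ge0 /=.
rewrite /dyadic scalerDr -!scalerBr norm_dyadic_scale.
by rewrite ler_pM2l ?invr_gt0 ?exp2_gt0.
Unshelve. all: by end_near. Qed.

End Limit.
End Dyadic.

(** * From additivity to linearity: Baire's theorem and local boundedness *)

(** Otherwise, for every [N], the open set where some [|F n u|] exceeds [N] is dense; by Baire these
    sets share a point, where the family is unbounded. *)
Lemma pointwise_bounded_locally_uniform {R : realType}
    {U : completeNormedModType R} {Y : normedModType R} {F : nat -> U -> Y} :
  (forall n, continuous (F n)) ->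
  (forall u, exists C, forall n, `|F n u| <= C) ->
  exists (a : U) (C : R), \forall u \near a, forall n, `|F n u| <= C.
Proof.
move=> cF bF; apply: contrapT => unb.
pose O (N : nat) : set U := \bigcup_n [set u | N%:R < `|F n u|].
have O_open N : open (O N).
  apply: bigcup_open => n _.
  apply: (@open_comp _ _ (fun u => `|F n u|) [set z | N%:R < z]).
    by move=> u _; apply: continuous_comp; [exact: cF|exact: norm_continuous].
  exact: open_gt.
have O_dense N : dense (O N).
  move=> V [a Va] oV; apply: contrapT => VO; apply: unb; exists a, N%:R.
  have /= : nbhs a V by exact: open_nbhs_nbhs.
  apply: filterS => u Vu n; rewrite leNgt; apply/negP => Nlt.
  by apply: VO; exists u; split => //; exists n.
have [] := @Baire _ U O (fun N => conj (O_open N) (O_dense N)) setT.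
- by exists 0.
- exact: openT.
move=> u [_ Ou]; have [C FC] := bF u.
have [n _ /=] := Ou (Num.truncn `|C|).+1 I.
apply/negP; rewrite -leNgt (le_trans (FC n)) // (le_trans (ler_norm _)) //.
by rewrite ltW // truncnS_gt.
Qed.

Lemma additive_mulrn {R : pzRingType} {V W : lmodType R} {G : V -> W} :
  {morph G : x y / x + y} -> forall (n : nat) x, G (n%:R *: x) = n%:R *: G x.
Proof.
move=> addG n x.
have G0 : G 0 = 0 by apply: (addrI (G 0)); rewrite -addG !addr0.
elim: n => [|n IH]; first by rewrite !scale0r.
by rewrite -addn1 natrD !scalerDl !scale1r addG IH.
Qed.

Lemma additive_opp {V W : zmodType} {G : V -> W} :
  {morph G : x y / x + y} -> {morph G : x / - x}.
Proof.
move=> addG x.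
have G0 : G 0 = 0 by apply: (addrI (G 0)); rewrite -addG !addr0.
by apply: (addrI (G x)); rewrite -addG !subrr.
Qed.

Section AdditiveReal.
Context {R : realType} {Y : normedModType R}.
Implicit Type G : R -> Y.

(** A nonzero value [G u] would make [G (n%:R *: u)] exceed any bound. *)
Lemma additive_bounded_eq0 {G} {C : R} :
  {morph G : x y / x + y} -> (forall u, `|G u| <= C) -> forall u, G u = 0.
Proof.
move=> addG GC u; apply/eqP; rewrite -normr_eq0; apply/eqP.
apply/le_anti; rewrite normr_ge0 andbT leNgt; apply/negP => Gu.
have := GC ((Num.truncn (C / `|G u|)).+1%:R *: u).
rewrite additive_mulrn // normrZ normr_nat -ler_pdivlMr //.
by apply/negP; rewrite -ltNge truncnS_gt.
Qed.

(* Subtracting [u *: G 1] leaves an additive function of period 1, for which a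
   bound near one point is a global bound. *)
Lemma additive_locally_bounded_linear {G} {a C : R} :
  {morph G : x y / x + y} -> (\forall u \near a, `|G u| <= C) ->
  forall u, G u = u *: G 1.
Proof.
move=> addG /nbhs_normP[d /= d0 GC].
(* Additivity moves the local bound from [a] to 0. *)
have GC0 v : `|v| < d -> `|G v| <= C + C.
  move=> vd; have -> : v = (a + v) + - a by rewrite addrAC subrr add0r.
  rewrite addG (additive_opp addG) (le_trans (ler_normB _ _)) // lerD //.
    by apply: GC; rewrite /ball_ /= opprD addrA subrr add0r normrN.
  by apply: GC; rewrite /ball_ /= subrr normr0.
pose m := (Num.truncn d^-1).+1.
have md : m%:R^-1 < d.
  by rewrite -[d]invrK ltf_pV2 ?posrE ?invr_gt0 ?ltr0n // truncnS_gt.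
pose H u := G u - u *: G 1.
have addH : {morph H : x y / x + y}.
  by move=> x y; rewrite /H addG scalerDl opprD addrACA.
have H1 : H 1 = 0 by rewrite /H scale1r subrr.
have Hint (k : int) : H k%:~R = 0.
  have Hnat (n : nat) : H n%:R = 0.
    have := additive_mulrn addH n 1.
    by rewrite H1 scaler0 /GRing.scale /= mulr1.
  by case: k => n;
    rewrite ?NegzE ?mulrNz ?(additive_opp addH) -?pmulrn Hnat ?oppr0.
move=> u; apply/eqP; rewrite -subr_eq0; apply/eqP; rewrite -/(H u).
apply: (@additive_bounded_eq0 H (m%:R * (C + C + `|G 1|)) addH) => v.
(* [H] sees only the fractional part [w] of [v]; since [m%:R^-1 < d], dividing [w] by [m] brings it
   into the ball where [GC0] applies. *)
pose w : R := v - (Num.floor v)%:~R.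
have Hvw : H v = m%:R *: H (m%:R^-1 * w).
  rewrite -additive_mulrn // /GRing.scale /= mulVKf ?pnatr_eq0 //.
  by rewrite /w addH (additive_opp addH) Hint oppr0 addr0.
have w0 : 0 <= w by rewrite subr_ge0 floor_le.
have w1 : w <= 1 by rewrite lerBlDl ltW // -intrD1 floorD1_gt.
have mw : `|m%:R^-1 * w| <= m%:R^-1.
  by rewrite ger0_norm ?mulr_ge0 ?invr_ge0 // ler_piMr ?invr_ge0.
rewrite Hvw normrZ normr_nat ler_pM2l ?ltr0n // (le_trans (ler_normB _ _)) //.
rewrite lerD ?GC0 //; first exact: le_lt_trans mw md.
rewrite normrZ ler_piMl // (le_trans mw) // invf_le1 ?ltr0n //.
by rewrite ler1n.
Qed.

End AdditiveReal.

(** * Finiteness of the control series and the bounds for g and h *)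

Section PexiderBounds.
Context {R : realType} {X : lmodType R}.

Lemma phi_tildeE {r s t : nat} {phi : X -> X -> R} {x y : X} :
  (0 < r)%N -> (forall x y, 0 <= phi x y) ->
  (phi_tilde r s t phi x y < +oo)%E ->
  cvgn (series (phi_term r s t phi x y)) /\
  phi_tilde r s t phi x y =
    ((2 * r%:R)^-1 * limn (series (phi_term r s t phi x y)))%:E.
Proof.
move=> r0 phi0; set u := phi_term r s t phi x y.
have u0 n : 0 <= u n by rewrite mulr_ge0 ?invr_ge0 ?exprn_ge0 // !addr_ge0.
have c0 : 0 < (2 * r%:R)^-1 :> R by rewrite invr_gt0 mulr_gt0 ?ltr0n.
have S0 : (0 <= \sum_(0 <= n <oo) (u n)%:E)%E.
  by apply: nneseries_ge0 => n _ _; rewrite lee_fin.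
rewrite /phi_tilde -/u => fin.
have cu : cvgn (series u).
  apply: nondecreasing_is_cvgn.
    by apply/nondecreasing_seqP => n; rewrite seriesSr lerDl.
  (* A finite sum bounds the partial sums; the value +oo would survive multiplication by the
     positive constant, and nonnegativity rules out -oo. *)
  case: (\sum_(0 <= n <oo) (u n)%:E)%E S0
      (@nneseries_lim_ge R (EFin \o u) xpredT 0) fin => [S| |] //= _ uS; last by rewrite gt0_muley ?lte_fin.
  move=> _; exists S => _ [n _ <-]; rewrite -lee_fin /series /= -sumEFin.
  by apply: uS => k _ _; rewrite lee_fin.
split=> //; rewrite EFinM -EFin_lim //; congr (_ * limn _)%E.
by apply/funext => n; rewrite /= /series /= sumEFin.
Qed.

(** With [z = (s/r) x], additivity gives [r T z = s T x], so the error of [g] at [x] splits into the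
    defect between [f] and [g] and the error of [f] at [z]. Taking [t] for [s] serves [h]. *)
Lemma pexider_component {Y : normedModType R} {r s : nat} {f g T : X -> Y}
    {x : X} {p E : R} :
  (0 < r)%N -> (0 < s)%N -> {morph T : x y / x + y} ->
  `|r%:R *: f ((s%:R / r%:R) *: x) - s%:R *: g x| <= p ->
  `|f ((s%:R / r%:R) *: x) - T ((s%:R / r%:R) *: x)| <= E ->
  `|g x - T x| <= s%:R^-1 * p + r%:R / s%:R * E.
Proof.
move=> r0 s0 addT fg fT; set z := (s%:R / r%:R) *: x in fg fT.
have rn0 : r%:R != 0 :> R by rewrite pnatr_eq0 -lt0n.
have sn0 : s%:R != 0 :> R by rewrite pnatr_eq0 -lt0n.
have rTz : r%:R *: T z = s%:R *: T x.
  rewrite -(additive_mulrn addT r) -(additive_mulrn addT s) /z scalerA.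
  by rewrite mulrCA divff // mulr1.
have -> : g x - T x = s%:R^-1 *: - (r%:R *: f z - s%:R *: g x) +
                      (r%:R / s%:R) *: (f z - T z).
  rewrite opprB scalerBr scalerK // (mulrC r%:R) -scalerA !scalerBr rTz.
  by rewrite scalerK // addrA subrK.
rewrite (le_trans (ler_normD _ _)) // lerD // normrZ
  ger0_norm ?divr_ge0 ?invr_ge0 //.
  by rewrite normrN ler_wpM2l ?invr_ge0.
by rewrite ler_wpM2l ?divr_ge0.
Qed.

End PexiderBounds.

(** * The stability theorem *)

Theorem theorem2p1 (R : realType) (X : lmodType R)
    (Y : completeNormedModType R) (r s t : nat)
    (r_gt0 : (0 < r)%N) (s_gt0 : (0 < s)%N) (t_gt0 : (0 < t)%N)
    (f g h : X -> Y) (f0 : f 0 = 0) (g0 : g 0 = 0) (h0 : h 0 = 0)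
    (phi : X -> X -> R) (phi_ge0 : forall x y : X, 0 <= phi x y)
    (phi_tilde_fin : forall x y : X, (phi_tilde r s t phi x y < +oo)%E)
    (fgh_phi : forall x y : X,
      `|r%:R *: f (r%:R^-1 *: (s%:R *: x + t%:R *: y))
        - s%:R *: g x - t%:R *: h y| <= phi x y) :
  exists T : X -> Y,
    unique (pexider_approx r s t f g h phi) T /\
    ((forall x : X, continuous (fun mu : R => f (mu *: x))) -> linear T).
Proof.
have rn0 : r%:R != 0 :> R by rewrite pnatr_eq0 -lt0n.
have sn0 : s%:R != 0 :> R by rewrite pnatr_eq0 -lt0n.
have tn0 : t%:R != 0 :> R by rewrite pnatr_eq0 -lt0n.
(* The bracket of the control series at rank 0; the later terms are its dyadic rescalings. *)
pose psi x y := phi ((r%:R / s%:R) *: x) ((r%:R / t%:R) *: y) +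
  phi ((r%:R / s%:R) *: x) 0 + phi 0 ((r%:R / t%:R) *: y).
have phi_termE x y n : phi_term r s t phi x y n =
    (2 ^+ n)^-1 * psi (2 ^+ n *: x) (2 ^+ n *: y).
  by rewrite /phi_term /psi !scalerA !(mulrC (2 ^+ n) (_ / _)).
have fg x : `|r%:R *: f ((s%:R / r%:R) *: x) - s%:R *: g x| <= phi x 0.
  by have := fgh_phi x 0; rewrite h0 !scaler0 addr0 subr0 scalerA mulrC.
have fh x : `|r%:R *: f ((t%:R / r%:R) *: x) - t%:R *: h x| <= phi 0 x.
  by have := fgh_phi 0 x; rewrite g0 !scaler0 add0r subr0 scalerA mulrC.
have rs_sr (p q : R) (z : X) :
    p != 0 -> q != 0 -> (q / p) *: ((p / q) *: z) = z.
  by move=> ? ?; rewrite scalerA mulrA divfK // divff // scale1r.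
have f_add x y : `|f (x + y) - f x - f y| <= r%:R^-1 * psi x y.
  rewrite ler_pdivlMl ?ltr0n // -[X in X * _](normr_nat R) -normrZ.
  have := fgh_phi ((r%:R / s%:R) *: x) ((r%:R / t%:R) *: y).
  have := fg ((r%:R / s%:R) *: x); have := fh ((r%:R / t%:R) *: y).
  rewrite !rs_sr // !scalerA !(mulrC _ (r%:R / _)) !divfK //.
  rewrite -scalerDr scalerK //.
  set G := s%:R *: _; set H := t%:R *: _ => fhy fgx fgh.
  (* The terms [G] and [H] of g and h cancel among the three inequalities. *)
  have -> : r%:R *: (f (x + y) - f x - f y) =
      (r%:R *: f (x + y) - G - H) - (r%:R *: f x - G) - (r%:R *: f y - H).
    rewrite !scalerBr; move: (r%:R *: _) (r%:R *: _) (r%:R *: _) => p q u.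
    by rewrite !opprB !addrA [_ - H + G]addrAC subrK [_ - H - q]addrAC subrK.
  rewrite (le_trans (ler_normB _ _)) // lerD // (le_trans (ler_normB _ _)) //.
  by rewrite lerD.
(* Half of the bound [f_add] at [(x, x)], since [f x - f (2x) / 2] is minus half the defect there;
   its dyadic series sums to [phi_tilde] on the diagonal. *)
pose e x := (2 * r%:R)^-1 * psi x x.
have errE x : dyadic_error e x = (2 * r%:R)^-1 *: phi_term r s t phi x x.
  apply/funext => n.
  rewrite -[RHS]/((2 * r%:R)^-1 * phi_term r s t phi x x n) phi_termE.
  by rewrite /dyadic_error /e mulrCA.
have term_cvg x y : cvgn (series (phi_term r s t phi x y)).
  by case: (phi_tildeE r_gt0 phi_ge0 (phi_tilde_fin x y)).
have e_summable x : cvgn (series (dyadic_error e x)).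
  by rewrite errE; exact: is_cvg_seriesZ.
have tildeE x : phi_tilde r s t phi x x = (limn (series (dyadic_error e x)))%:E.
  have [_ ->] := phi_tildeE r_gt0 phi_ge0 (phi_tilde_fin x x).
  by rewrite errE lim_seriesZ.
have f_half x : `|f x - 2^-1 *: f (2 *: x)| <= e x.
  have -> : f x - 2^-1 *: f (2 *: x) = - (2^-1 *: (f (x + x) - f x - f x)).
    have fx2 : 2^-1 *: f x + 2^-1 *: f x = f x.
      by rewrite -scalerDr -mulr2n -(scaler_nat 2 (f x)) scalerK ?pnatr_eq0.
    by rewrite (scaler_nat 2) mulr2n -{1}fx2 !scalerBr !opprB addrA.
  rewrite normrN normrZ ger0_norm ?invr_ge0 // /e invfM -mulrA.
  by rewrite ler_pM2l ?invr_gt0.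
pose T := dyadic_lim f.
have addT : {morph T : x y / x + y}.
  apply: (dyadic_limD f_half e_summable f_add) => x y.
  have := cvg_series_cvg_0 (term_cvg x y).
  rewrite (_ : phi_term _ _ _ _ _ _ = 
      fun n => (2 ^+ n)^-1 * psi (2 ^+ n *: x) (2 ^+ n *: y)); last first.
    by apply/funext => n; exact: phi_termE.
  move=> psi0; under eq_fun do rewrite mulrCA.
  by rewrite -(mulr0 r%:R^-1); apply: cvgM => //; exact: cvg_cst.
have fT x : `|f x - T x| <= limn (series (dyadic_error e x)).
  exact: (dyadic_lim_le f_half e_summable).
exists T; split; first split.
- split=> // x; first by rewrite tildeE lee_fin.
  + rewrite tildeE -EFinM -EFinD lee_fin.
    exact: (pexider_component r_gt0 s_gt0 addT (fg x) (fT _)).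
  + rewrite tildeE -EFinM -EFinD lee_fin.
    exact: (pexider_component r_gt0 t_gt0 addT (fh x) (fT _)).
- move=> T' [addT' fT' _ _]; apply/funext => x.
  apply/cvg_lim => //.
  (* With the total error as [E], the rescaled errors are the tails of the convergent series at [x],
     so they vanish in the limit. *)
  apply: (dyadic_cvg_unique
    (E := fun z => limn (series (dyadic_error e z))) addT').
    by move=> z; have := fT' z; rewrite tildeE lee_fin.
  have := cvg_series_tail (e_summable x).
  under eq_fun do rewrite dyadic_error_shift.
  by under eq_fun do rewrite (lim_seriesZ _ (e_summable _)).
(* Only homogeneity remains; it is proved on the line spanned by [x]. *)
- move=> cf a x y; rewrite addT; congr (_ + _).
  pose F n (u : R) := dyadic f n (u *: x).
  have cF n : continuous (F n).
    rewrite (_ : F n = fun u => (2 ^+ n)^-1 *: f (u *: (2 ^+ n *: x))).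
      by move=> u; apply: cvgZr; exact: cf.
    by apply/funext => u; rewrite /F /dyadic !scalerA mulrC.
  have bF u : exists C, forall n, `|F n u| <= C.
    have /cvg_seq_bounded[M [_ FM]] := dyadic_is_cvg f_half e_summable (u *: x).
    (* [FM] gives a bound for each constant strictly above [M], hence [M + 1]. *)
    by exists (M + 1) => n; apply: (FM (M + 1)); rewrite ?ltrDl.
  have [b [C FC]] := pointwise_bounded_locally_uniform cF bF.
  have addTx : {morph (fun u => T (u *: x)) : u v / u + v}.
    by move=> u v /=; rewrite scalerDl addT.
  have := @additive_locally_bounded_linear
    _ _ (fun u => T (u *: x)) b C addTx _ a.
  rewrite scale1r; apply; apply: filterS FC => u Fu.
  (* The bound [C], uniform in [n], passes to the limit. *)
  have cu : `|F n u| @[n --> \oo] --> `|T (u *: x)|.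
    by apply: cvg_norm; exact: (dyadic_is_cvg f_half e_summable).
  by apply: (cvgr_to_le cu); exact: nearW.
Qed.
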